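(* Let $G$ be a finite cyclic group of order $n=p_1^{\alpha_1}p_2^{\alpha_2}\cdots p_r^{\alpha_r}\geq 3$, where the $p_i$ are distinct primes and the $\alpha_i$ are positive integers for $1\leq i\leq r$. Let $\Gamma_{G,H}$ be the generalized non-coprime graph of $G$ with respect to a subgroup $H\neq\{e\}$ of $G$. Then the following are true: (i) If $G$ is a $p$-group, then $\delta(\Gamma_{G,H})=|G|-2$ if $H=G$, and $\delta(\Gamma_{G,H})=|H|-1$ if $H$ is a proper subgroup of $G$. (ii) If $G$ is not a $p$-group and $\Gamma_{G,H}$ is connected, then \[\delta(\Gamma_{G,H})=\min\{\deg_{\Gamma_{G,H}}(x_i) : x_i\in G \text{ and } |x_i|=p_i^{\alpha_i} \text{ for some } i\ (1\leq i\leq r)\}.\] (iii) If $\Gamma_{G,H}$ is disconnected, then $\delta(\Gamma_{G,H})=0$.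
   Context: For a finite group $G$ with identity $e$ and a subgroup $H\neq\{e\}$ of $G$, the generalized non-coprime graph $\Gamma_{G,H}$ is the simple undirected graph with vertex set $G\setminus\{e\}$ in which two distinct vertices $a,b$ are adjacent if and only if $\gcd(|a|,|b|)\neq 1$ and ($a\in H$ or $b\in H$), where $|a|$ denotes the order of the element $a$. $\delta(\Gamma)$ denotes the minimum degree of the graph $\Gamma$. A $p$-group means a group whose order is a power of some prime $p$. *)

(* Defs.v *)
From HB Require Import structures.
From mathcomp Require Import all_boot all_order all_fingroup all_solvable.

Set Implicit Arguments.
Unset Strict Implicit.
Unset Printing Implicit Defensive.

Import GroupScope.

Record sgraph := SGraph {
  vertex :> finType;
  adj : rel vertex;
  adj_sym : symmetric adj;
  adj_irr : irreflexive adj }.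

Definition degree (g : sgraph) (x : g) : nat := #|[set y | adj x y]|.

(* Every degree is at most #|g|, so on a nonempty graph the default value
   #|g| does not affect the minimum. *)
Definition min_degree (g : sgraph) : nat :=
  \big[minn/#|g|]_(x : g) degree x.

Definition connected (g : sgraph) : Prop :=
  forall x y : g, connect (@adj g) x y.

Definition is_minimum (S : nat -> Prop) (m : nat) : Prop :=
  S m /\ forall k, S k -> m <= k.

Definition prime_power_group (gT : finGroupType) (G : {group gT}) : Prop :=
  exists2 p : nat, prime p & p.-group G.

Section NonCoprimeGraph.

Variables (gT : finGroupType) (G H : {group gT}).

Definition nc_vertex : finType := {x : gT | x \in G^#}.

Definition nc_adj : rel nc_vertex := fun a b =>
  [&& a != b, gcdn #[val a] #[val b] != 1%N & (val a \in H) || (val b \in H)].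

Fact nc_adj_sym : symmetric nc_adj.
Proof. by move=> a b; rewrite /nc_adj eq_sym gcdnC orbC. Qed.

Fact nc_adj_irr : irreflexive nc_adj.
Proof. by move=> a; rewrite /nc_adj eqxx. Qed.

Definition noncoprime_graph : sgraph := SGraph nc_adj_sym nc_adj_irr.

End NonCoprimeGraph.

(* Main.v *)
Require Import Defs.
From HB Require Import structures.
From mathcomp Require Import all_boot all_order all_fingroup all_solvable.

Set Implicit Arguments.
Unset Strict Implicit.
Unset Printing Implicit Defensive.

Import GroupScope.

(** Write N(x) for the neighbourhood of x.  A vertex z whose order is a power
    of the prime p shares a factor with y exactly when p divides the order of
    y, so z has the fewest possible neighbours among the vertices whose order
    is divisible by p, as long as z is not favoured over them by lying in H.

    If p divides the order of x and x lies in H, then z together with N(z) is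
    contained in the set of vertices of order divisible by p, which is contained
    in x together with N(x); hence deg z <= deg x.  If neither x nor z lies
    in H, then N(z) is the set of elements of H of order divisible by p, and N(x)
    contains it.  This is [leq_degree_pelt].

    For the cyclic group G, apply this to generators z of its Sylow subgroups.
    When x is in H any prime divisor p of its order serves.  When x is not
    in H, the order of x does not divide that of H, because a cyclic group has
    only one subgroup of each order; so some p-part of the order of x does not
    divide #|H|, and then the generator of the Sylow p-subgroup is not in H
    either.  Hence the minimum degree is reached at a generator of a Sylow
    subgroup ([exists_sylow_generator_leq]).

    In a p-group no two vertices have coprime orders: elements of H are joined
    to everything, and the others exactly to the nontrivial elements of H.

    Finally, if every prime divisor of #|G| divides #|H|, a generator of H
    is joined to all other vertices.  So a disconnected graph comes from a prime
    q dividing #|G| but not #|H|, and an element of order q is isolated. *)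

(** * Minimum degree of a graph *)

Section MinDegree.

Variable g : sgraph.

Lemma min_degree_leq (x : g) : min_degree g <= degree x.
Proof.
rewrite /min_degree; have := mem_index_enum x.
elim: (index_enum g) => // y s IHs; rewrite inE big_cons geq_min.
by case/predU1P=> [-> | /IHs ->]; rewrite ?leqnn ?orbT.
Qed.

Lemma min_degree_attained (x0 : g) : exists x : g, min_degree g = degree x.
Proof.
suff [dg|//]: min_degree g = #|g| \/ exists x : g, min_degree g = degree x.
  by exists x0; apply/eqP; rewrite eqn_leq min_degree_leq dg max_card.
rewrite /min_degree; elim/big_ind: _ => [|m n IHm IHn|x _]; first by left.
  by rewrite /minn; case: ifP.
by right; exists x.
Qed.

Lemma min_degree_eq (x : g) m :
  degree x = m -> (forall y : g, m <= degree y) -> min_degree g = m.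
Proof.
move=> dx le_m; have [y dy] := min_degree_attained x.
by apply/eqP; rewrite eqn_leq -{1}dx min_degree_leq dy le_m.
Qed.

End MinDegree.

(** * Divisibility *)

Lemma gcdn_neq1 (q m n : nat) : prime q -> q %| m -> q %| n -> gcdn m n != 1%N.
Proof.
move=> q_pr q_m q_n; apply: contraTneq (prime_gt1 q_pr) => gcd1.
by have := dvdn_gcd q m n; rewrite q_m q_n gcd1 dvdn1 => /eqP ->.
Qed.

Lemma pnat_gcdn_neq1 (q m n : nat) :
  q.-nat m -> gcdn m n != 1%N -> q %| n.
Proof.
move=> q_m; rewrite -/(coprime m n); apply: contraNT => q'n.
have [n0|n_gt0] := posnP n; first by rewrite n0 dvdn0 in q'n.
apply: (pnat_coprime q_m); apply/pnatP=> // s s_pr s_n.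
by rewrite !inE; apply: contraNneq q'n => <-.
Qed.

Lemma partn_prod_primes r (p alpha : 'I_r -> nat) i :
  (forall j, prime (p j)) -> injective p ->
  ((\prod_(j < r) p j ^ alpha j)`_(p i) = p i ^ alpha i)%N.
Proof.
move=> p_pr p_inj; rewrite (bigD1 i) //= partnM; first last.
- by rewrite prodn_gt0 // => j; rewrite expn_gt0 prime_gt0.
- by rewrite expn_gt0 prime_gt0.
rewrite part_pnat_id; last by rewrite pnatX pnat_id.
rewrite part_p'nat ?muln1 //; apply: (big_ind (fun m => (p i)^'.-nat m)) => //.
  by move=> m n pm pn; rewrite pnatM pm.
move=> j ne_ji; rewrite pnatX; apply/orP; left.
by rewrite pnatE // !inE; apply: contraNneq ne_ji => /p_inj ->.
Qed.

(** * Degrees in the generalized non-coprime graph *)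

Section Degrees.

Variables (gT : finGroupType) (G H : {group gT}).

Local Notation Gamma := (noncoprime_graph G H).

Lemma adjE (x y : Gamma) :
  adj x y = [&& x != y, gcdn #[val x] #[val y] != 1%N
                      & (val x \in H) || (val y \in H)].
Proof. by []. Qed.

Lemma vertex_in (x : Gamma) : val x \in G.
Proof. by have := valP x; rewrite in_setD => /andP[]. Qed.

Lemma vertex_neq1 (x : Gamma) : val x != 1.
Proof. by have := valP x; rewrite !inE => /andP[]. Qed.

Lemma vertex_of (a : gT) : a \in G -> a != 1 -> exists x : Gamma, val x = a.
Proof.
move=> aG a1; have aG1 : a \in G^# by rewrite !inE a1.
by exists (Sub a aG1).
Qed.

Lemma vertex_prime (x : Gamma) : exists2 q, prime q & q %| #[val x].
Proof.
exists (pdiv #[val x]); last exact: pdiv_dvd.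
by rewrite pdiv_prime // order_gt1 vertex_neq1.
Qed.

Lemma vertex_pelt_dvdn (q : nat) (x : Gamma) :
  q.-elt (val x) -> q %| #[val x].
Proof.
move=> q_x; have: 1%N < #[val x] by rewrite order_gt1 vertex_neq1.
by rewrite -[X in _ < X](part_pnat_id q_x) p_part_gt1 mem_primes => /and3P[].
Qed.

Lemma card_vertices_in (A : {group gT}) :
  A \subset G -> #|[set y : Gamma | val y \in A]| = #|A|.-1.
Proof.
move=> sAG; rewrite (cardsD1 1 A) group1 /= -(card_imset _ val_inj).
apply: eq_card => a; apply/imsetP/idP => [[y yA ->]|].
  by rewrite inE in yA; rewrite !inE vertex_neq1.
rewrite !inE => /andP[a1 aA]; have [y ya] := vertex_of (subsetP sAG a aA) a1.
by exists y; rewrite ?inE ya.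
Qed.

Lemma card_vertices : #|Gamma| = #|G|.-1.
Proof.
rewrite -(card_vertices_in (subxx G)) -cardsT.
by apply: eq_card => y; rewrite !inE vertex_in.
Qed.

(** Since z has no prime divisor but q, all its neighbours have order divisible
    by q, hence share the factor q with x.  Membership in H must pass from z
    to x because it brings neighbours outside H, which a vertex outside H
    does not have. *)
Lemma leq_degree_pelt (q : nat) (x z : Gamma) :
    prime q -> q.-elt (val z) -> q %| #[val x] ->
    (val z \in H -> val x \in H) ->
  degree z <= degree x.
Proof.
move=> q_pr q_z q_x zxH.
have adj_z y : adj z y -> q %| #[val y].
  by rewrite adjE => /and3P[_ /(pnat_gcdn_neq1 q_z)].
have [xH | x'H] := boolP (val x \in H).
  (* The open neighbourhoods need not be nested, as x may be adjacent to z;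
     the closed ones are. *)
  suff: z |: [set y | adj z y] \subset x |: [set y | adj x y].
    by move/subset_leq_card; rewrite !cardsU1 !inE !adj_irr.
  apply/subsetP=> y; rewrite !inE (adjE x) xH andbT (eq_sym y x).
  have [// | _ yz /=] := eqVneq x y.
  apply: (gcdn_neq1 q_pr q_x).
  by case/predU1P: yz => [-> | /adj_z //]; apply: vertex_pelt_dvdn.
apply/subset_leq_card/subsetP=> y; rewrite !inE => yz; have := yz.
rewrite !adjE (negPf x'H) (contraNF zxH x'H) /= => /and3P[_ _ yH].
rewrite yH (gcdn_neq1 q_pr q_x (adj_z y yz)) !andbT.
by apply: contraNneq x'H => ->.
Qed.

(** * Comparison with Sylow generators *)

Lemma exists_sylow_generator (q : nat) :
    cyclic G -> prime q -> q %| #|G| ->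
  exists z : Gamma, #[val z] = (#|G|`_q)%N.
Proof.
move=> /cyclicP[a Ga] q_pr q_G.
have oaq : #[a.`_q] = (#|G|`_q)%N by rewrite order_constt orderE -Ga.
have [z za] : exists z : Gamma, val z = a.`_q.
  apply: vertex_of; first by rewrite groupX // Ga cycle_id.
  by rewrite -order_gt1 oaq p_part_gt1 mem_primes q_pr cardG_gt0.
by exists z; rewrite za.
Qed.

(** The prime q is chosen so that a generator of the Sylow q-subgroup lies in H
    only if x does.  For x outside H, cyclicity provides it: the order of x
    cannot divide #|H|, so its q-part fails to divide #|H| for some q, and a
    fortiori so does the q-part of #|G|. *)
Lemma exists_sylow_generator_leq (x : Gamma) :
    cyclic G -> H \subset G ->
  exists (z : Gamma) (q : nat),
    [/\ prime q, q %| #|G|, #[val z] = (#|G|`_q)%N & degree z <= degree x].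
Proof.
move=> cycG sHG.
suff [q [q_pr q_x]] : exists q, [/\ prime q, q %| #[val x]
    & forall z : Gamma, #[val z] = (#|G|`_q)%N -> val z \in H -> val x \in H].
  have q_G : q %| #|G| := dvdn_trans q_x (order_dvdG (vertex_in x)).
  have [z oz] := exists_sylow_generator cycG q_pr q_G.
  move=> /(_ z oz) zxH; exists z, q; split=> //.
  by apply: leq_degree_pelt q_x zxH; rewrite // /p_elt oz part_pnat.
have [xH | x'H] := boolP (val x \in H).
  by have [q q_pr q_x] := vertex_prime x; exists q; split.
have x_ndvd_H : ~~ (#[val x] %| #|H|).
  by rewrite orderE (cardSg_cyclic cycG) ?cycle_subG ?vertex_in.
have /allPn[q] :
    ~~ all (fun q : nat => (#[val x]`_q)%N %| #|H|) (primes #[val x]).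
  by apply: contra x_ndvd_H => /allP allH; apply/dvdn_partP.
rewrite mem_primes => /and3P[q_pr _ q_x] q_part.
exists q; split=> // z oz zH.
case/negP: q_part; apply: dvdn_trans (order_dvdG zH).
by rewrite oz partn_dvd ?cardG_gt0 // order_dvdG ?vertex_in.
Qed.

(** * Degrees in the graph of a p-group *)

Lemma pgroup_gcdn_neq1 (q : nat) (x y : Gamma) :
  prime q -> q.-group G -> gcdn #[val x] #[val y] != 1%N.
Proof.
move=> q_pr qG.
by apply: (gcdn_neq1 q_pr); apply/vertex_pelt_dvdn/(mem_p_elt qG)/vertex_in.
Qed.

Lemma degree_pgroup_in (q : nat) (x : Gamma) :
  prime q -> q.-group G -> val x \in H -> degree x = #|G|.-2.
Proof.
move=> q_pr qG xH; rewrite /degree.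
have -> : [set y | adj x y] = [set~ x].
  apply/setP=> y; rewrite !inE adjE xH andbT eq_sym.
  by rewrite (pgroup_gcdn_neq1 _ _ q_pr qG) andbT.
by rewrite cardsC1 card_vertices.
Qed.

Lemma degree_pgroup_notin (q : nat) (x : Gamma) :
    prime q -> q.-group G -> H \subset G -> val x \notin H ->
  degree x = #|H|.-1.
Proof.
move=> q_pr qG sHG x'H; rewrite -(card_vertices_in sHG).
apply: eq_card => y; rewrite !inE adjE (negPf x'H).
rewrite (pgroup_gcdn_neq1 _ _ q_pr qG) /=.
by apply: andb_idl => yH; apply: contraNneq x'H => ->.
Qed.

(** * Connectedness *)

(** A generator of H has order divisible by every prime divisor of #|G|, so
    it is adjacent to all other vertices. *)
Lemma connected_of_primes :
    cyclic G -> H \subset G -> H :!=: 1 ->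
    (forall q, prime q -> q %| #|G| -> q %| #|H|) ->
  connected Gamma.
Proof.
move=> cycG sHG ntH allH; have /cyclicP[a Ha] := cyclicS sHG cycG.
have aH : a \in H by rewrite Ha cycle_id.
have a1 : a != 1 by rewrite -cycle_eq1 -Ha.
have [h ha] := vertex_of (subsetP sHG a aH) a1.
have to_h x : connect (@adj Gamma) x h.
  have [-> // | ne_xh] := eqVneq x h; apply: connect1.
  have [q q_pr q_x] := vertex_prime x.
  rewrite adjE ne_xh ha aH orbT andbT (gcdn_neq1 q_pr q_x) //.
  rewrite orderE -Ha allH //.
  exact: dvdn_trans q_x (order_dvdG (vertex_in x)).
move=> x y; apply: connect_trans (to_h x) _.
by rewrite (sym_connect_sym (@adj_sym Gamma)) to_h.
Qed.

Lemma degree_prime_notin (q : nat) (x : Gamma) :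
  prime q -> ~~ (q %| #|H|) -> #[val x] = q -> degree x = 0%N.
Proof.
move=> q_pr q'H ox; apply/eqP; rewrite cards_eq0 -subset0.
apply/subsetP=> y; rewrite !inE adjE ox => /and3P[_ gcd_qy].
have q_y : q %| #[val y] by apply: pnat_gcdn_neq1 gcd_qy; rewrite pnat_id.
by case/orP=> /order_dvdG; rewrite ?ox => /(dvdn_trans _) qH;
   case/negP: q'H; apply: qH.
Qed.

End Degrees.

(** * Minimum degree for cyclic groups *)

Theorem lemma2p5 (gT : finGroupType) (G H : {group gT})
    (r : nat) (p alpha : 'I_r -> nat)
    (p_prime : forall i, prime (p i)) (p_inj : injective p)
    (alpha_gt0 : forall i, (0 < alpha i)%N)
    (cardG : #|G| = (\prod_(i < r) p i ^ alpha i)%N) (cardG_ge3 : (3 <= #|G|)%N)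
    (cycG : cyclic G) (sHG : H \subset G) (ntH : H :!=: 1) :
  let Gamma := noncoprime_graph G H in
  [/\ prime_power_group G ->
        (H :=: G -> min_degree Gamma = (#|G| - 2)%N) /\
        (H \proper G -> min_degree Gamma = (#|H| - 1)%N),
      ~ prime_power_group G -> connected Gamma ->
        is_minimum
          (fun d => exists (x : Gamma) (i : 'I_r),
             #[val x] = (p i ^ alpha i)%N /\ d = degree x)
          (min_degree Gamma)
    & ~ connected Gamma -> min_degree Gamma = 0%N].
Proof.
move=> Gamma.
have [b bH b1] : exists2 b, b \in H & b != 1 by exact/trivgPn.
have [x0 _] := vertex_of H (subsetP sHG b bH) b1.
split.
- case=> q q_pr qG; split=> [HG | /properP[_ [c cG c'H]]].
    rewrite subn2.
    have inH (y : Gamma) : val y \in H by rewrite HG vertex_in.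
    apply: (min_degree_eq (x := x0)) => [|y].
      exact: degree_pgroup_in q_pr qG (inH x0).
    by rewrite (degree_pgroup_in q_pr qG (inH y)).
  have c1 : c != 1 by apply: contraNneq c'H => ->.
  have [x xc] := vertex_of H cG c1.
  have ltHG : #|H| < #|G|.
    by apply/proper_card/properP; split=> //; exists c.
  rewrite subn1; apply: (min_degree_eq (x := x)) => [|y].
    by apply: (degree_pgroup_notin q_pr qG sHG); rewrite xc.
  have [yH | y'H] := boolP (val y \in H).
    rewrite (degree_pgroup_in q_pr qG yH) -!subn1 leq_sub2r //.
    by rewrite subn1 -ltnS prednK.
  by rewrite (degree_pgroup_notin q_pr qG sHG y'H).
- move=> _ _; split=> [|k [x [i [_ ->]]]]; last exact: min_degree_leq.
  have [x dx] := min_degree_attained x0.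
  have [z [q [q_pr q_G oz le_zx]]] := exists_sylow_generator_leq x cycG sHG.
  have [i q_i] : exists i, q = p i.
    move: q_G; rewrite cardG Euclid_dvd_prod // big_orE => /existsP[i] /=.
    by rewrite Euclid_dvdX // dvdn_prime2 // => /andP[/eqP q_i _]; exists i.
  exists z, i; split; first by rewrite oz q_i cardG partn_prod_primes.
  by apply/eqP; rewrite eqn_leq min_degree_leq dx le_zx.
- move=> disconnG; apply/eqP; rewrite -leqn0.
  have /allPn[q] : ~~ all (fun q => q %| #|H|) (primes #|G|).
    apply/negP=> /allP allH; case: disconnG.
    apply: connected_of_primes => // q q_pr q_G.
    by apply: allH; rewrite mem_primes q_pr cardG_gt0.
  rewrite mem_primes => /and3P[q_pr _ q_G] q'H.
  have [c cG oc] := Cauchy q_pr q_G.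
  have c1 : c != 1 by rewrite -order_gt1 oc prime_gt1.
  have [x xc] := vertex_of H cG c1.
  rewrite -(degree_prime_notin (x := x) q_pr q'H) ?xc //.
  exact: min_degree_leq.
Qed.
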